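(* Let $A$ be an abelian variety of dimension $g\geq2$ over the finite field $\mathbb{F}_q$, let $n\geq2$, and let $B_n=B_n(A)$. (i) If $n>4\log_q\bigl(1+(2g)^{1/2}\bigr)$, that is, if $g<\dfrac{(q^{n/4}-1)^2}{2}$, then $B_n\geq1$. (ii) If $g\leq\dfrac{q-q^{1/2}}{2}$, then $B_n\geq0$. (iii) If $n\geq g$, then $B_n\geq1$, unless $2\leq g\leq9$ and $q\leq5$. (iv) If $n\geq2g$, then $B_n\geq1$, unless $2\leq g\leq3$ and $q=2$. If so (that is, if $2\le g\le 3$ and $q=2$), $B_n\geq1$ if $n\geq2g+1$.
   Context: Let $A$ be an abelian variety of dimension $g$ over $\mathbb{F}_q$, with Weil polynomial $f_A(t)$ (characteristic polynomial of its Frobenius endomorphism), whose complex roots are $\omega_1,\dots,\omega_g,\overline\omega_1,\dots,\overline\omega_g$, with $|\omega_i|=q^{1/2}$. Put $P_A(t)=t^{2g}f_A(t^{-1})$ and $Z_A(t)=\dfrac{P_A(t)}{(1-t)(1-qt)}$. The numbers $N_n=N_n(A)$ are defined by $\log Z_A(t)=\sum_{n\ge1}N_n\frac{t^n}{n}$, equivalently $N_n=q^n+1-\sum_{i=1}^g(\omega_i^n+\overline\omega_i^n)$ (this is not $|A(\mathbb{F}_{q^n})|$), and $$B_n=B_n(A)=\frac1n\sum_{d\mid n}\mu\Bigl(\frac nd\Bigr)N_d,$$ where $\mu$ is the Möbius function. The $B_n$ and $N_n$ are integers. *)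

(* Defs.v *)
From HB Require Import structures.
From mathcomp Require Import all_boot all_order all_algebra.
From mathcomp Require Import mpoly classical_sets reals complex.

Set Implicit Arguments.
Unset Strict Implicit.
Unset Printing Implicit Defensive.

Import Order.TTheory GRing.Theory Num.Theory.
Local Open Scope classical_set_scope.
Local Open Scope complex_scope.
Local Open Scope ring_scope.

(* A subvariety of projective space over an algebraically closed field K is
   presented by its type X of K-points together with a map c choosing one vector
   of homogeneous coordinates for each point; hcoords c x v says that v is some
   vector of homogeneous coordinates of x, and is what all notions below depend
   on, so that the choice made by c is immaterial. *)
Definition hcoords (K : fieldType) (m : nat) (X : Type) (c : X -> 'rV[K]_m)
    (x : X) (v : 'rV[K]_m) : Prop :=
  exists2 a : K, a != 0 & v = a *: c x.

Definition homogeneous (k : fieldType) (m : nat) (p : {mpoly k[m]}) : Prop :=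
  exists d : nat, p \is d.-homog.

Definition zariski_closed (K : fieldType) (m : nat) (X : Type)
    (c : X -> 'rV[K]_m) (Z : set X) : Prop :=
  exists S : set {mpoly K[m]},
    (forall p, S p -> homogeneous p) /\
    Z = [set x | forall p, S p -> p.@[c x 0] = 0].

Definition irreducible_closed (K : fieldType) (m : nat) (X : Type)
    (c : X -> 'rV[K]_m) (Z : set X) : Prop :=
  [/\ zariski_closed c Z, Z !=set0 &
      forall Z1 Z2 : set X, zariski_closed c Z1 -> zariski_closed c Z2 ->
        Z `<=` Z1 `|` Z2 -> Z `<=` Z1 \/ Z `<=` Z2].

Definition irreducible_chain (K : fieldType) (m : nat) (X : Type)
    (c : X -> 'rV[K]_m) (g : nat) : Prop :=
  exists Z : nat -> set X,
    (forall i, (i <= g)%N -> irreducible_closed c (Z i)) /\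
    (forall i, (i < g)%N -> Z i `<` Z i.+1).

Definition krull_dim (K : fieldType) (m : nat) (X : Type)
    (c : X -> 'rV[K]_m) (g : nat) : Prop :=
  irreducible_chain c g /\ ~ irreducible_chain c g.+1.

Definition eval_along (F K : fieldType) (iota : {rmorphism F -> K}) (n m : nat)
    (h : 'I_m -> {mpoly F[n]}) (v : 'rV[K]_n) : 'rV[K]_m :=
  \row_i mmap iota (v 0) (h i).

(* An abelian variety over F is a geometrically irreducible projective variety
   defined over F with a group law whose addition, opposite and neutral element
   are defined over F. It is given by the abstract group of its points over an
   algebraic closure K of F.
   A morphism defined over F is a map which, near every point, is given by
   polynomials over F in the homogeneous coordinates. The polynomials are not
   required to be homogeneous (bihomogeneous for the addition): the formula must
   hold for every choice of homogeneous coordinates, so that, K being infinite,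
   their (bi)homogeneous components satisfy it too. *)
Record abelian_variety (F : fieldType) (K : closedFieldType)
    (iota : {rmorphism F -> K}) := AbelianVariety {
  av_points :> zmodType;
  av_ambient : nat;
  av_coord : av_points -> 'rV[K]_av_ambient.+1;
  av_coord_neq0 : forall x, av_coord x != 0;
  av_coord_inj : forall x y, hcoords av_coord x (av_coord y) -> x = y;
  av_projective : exists S : set {mpoly F[av_ambient.+1]},
    (forall p, S p -> homogeneous p) /\
    forall v, v != 0 ->
      (exists x, hcoords av_coord x v) <->
      (forall p, S p -> mmap iota (v 0) p = 0);
  av_irreducible : irreducible_closed av_coord [set: av_points];
  av_zero_rational : exists v, hcoords av_coord 0 (map_mx iota v);
  av_opp_regular : forall x0, exists h : 'I_av_ambient.+1 ->
      {mpoly F[av_ambient.+1]},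
    eval_along iota h (av_coord x0) != 0 /\
    forall x v, hcoords av_coord x v ->
      eval_along iota h v != 0 ->
      hcoords av_coord (- x) (eval_along iota h v);
  av_add_regular : forall x0 y0, exists h : 'I_av_ambient.+1 ->
      {mpoly F[av_ambient.+1 + av_ambient.+1]},
    eval_along iota h (row_mx (av_coord x0) (av_coord y0)) != 0 /\
    forall x y v w, hcoords av_coord x v -> hcoords av_coord y w ->
      eval_along iota h (row_mx v w) != 0 ->
      hcoords av_coord (x + y) (eval_along iota h (row_mx v w))
}.

Definition is_frobenius (F : finFieldType) (K : closedFieldType)
    (iota : {rmorphism F -> K}) (A : abelian_variety iota) (pi : A -> A) : Prop :=
  forall x v, hcoords (@av_coord _ _ _ A) x v ->
    hcoords (@av_coord _ _ _ A) (pi x) (map_mx (fun a => a ^+ #|F|) v).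

(* f is the characteristic polynomial of pi on the Tate module T_l(A), for every
   prime l different from the characteristic. As T_l(A) is the limit of the
   groups A[l^k], free of rank 2g over Z/l^k, this is expressed modulo every l^k:
   e is an isomorphism from A[l^k] to (Z/l^k)^2g, and M the matrix of pi. *)
Definition tate_charpoly (F : finFieldType) (K : closedFieldType)
    (iota : {rmorphism F -> K}) (A : abelian_variety iota) (g : nat)
    (pi : A -> A) (f : {poly int}) : Prop :=
  forall l k : nat, prime l -> l \notin [pchar F] -> (0 < k)%N ->
  exists (e : A -> 'rV['Z_(l ^ k)]_(2 * g)) (M : 'M['Z_(l ^ k)]_(2 * g)),
    [/\ forall x y : A, x *+ (l ^ k) = 0 -> y *+ (l ^ k) = 0 ->
          e (x + y) = e x + e y,
        forall x : A, x *+ (l ^ k) = 0 -> e x = 0 -> x = 0,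
        forall u, exists2 x : A, x *+ (l ^ k) = 0 & e x = u,
        forall x : A, x *+ (l ^ k) = 0 -> e (pi x) = e x *m M
      & char_poly M = map_poly intr f].

Definition weil_polynomial (F : finFieldType) (K : closedFieldType)
    (iota : {rmorphism F -> K}) (A : abelian_variety iota) (g : nat)
    (f : {poly int}) : Prop :=
  exists2 pi : A -> A, is_frobenius pi & tate_charpoly g pi f.

Definition weil_roots (R : realType) (q g : nat) (f : {poly int})
    (omega : 'I_g -> R[i]) : Prop :=
  map_poly intr f =
    \prod_(i < g) (('X - (omega i)%:P) * ('X - ((omega i)^*)%:P)) /\
  forall i, `|omega i| = (Num.sqrt q%:R)%:C.

Definition moebius (n : nat) : int :=
  if all (fun p => logn p n == 1%N) (primes n) then (-1) ^+ size (primes n)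
  else 0.

(* N n / n is the coefficient of t^n in the logarithm of
   \prod_i (1 - omega_i t)(1 - conj(omega_i) t) / ((1 - t)(1 - q t)).
   N and B take integer values; they are typed in R[i], whose order is such that
   x <= y means that y - x is a nonnegative real number. *)
Definition N (R : realType) (q g : nat) (omega : 'I_g -> R[i]) (n : nat) : R[i] :=
  q%:R ^+ n + 1 - \sum_(i < g) (omega i ^+ n + (omega i)^* ^+ n).

Definition B (R : realType) (q g : nat) (omega : 'I_g -> R[i]) (n : nat) : R[i] :=
  n%:R^-1 * \sum_(d <- divisors n) (moebius (n %/ d))%:~R * N q omega d.

(* Main.v *)
Require Import Defs.
From HB Require Import structures.
From mathcomp Require Import all_boot all_order all_algebra finfield.
From mathcomp Require Import reals exp complex ring lra zify.

(** Write t = q^(1/4), x = t^n and G = 2g, and let T d be the trace of the d-th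
    power of Frobenius, so that |T d| <= G t^(2d).  Then n B_n is the sum over
    d | n of mu(n/d) (q^d + 1 - T d), whose term d = n is at least
    x^4 + 1 - G x^2.  A proper divisor d of n is either n/2 or at most n/3, and
    the sum of t^(2d) over those of the second kind with mu(n/d) <> 0 is at most
    x, once x > 3.  Hence n B_n >= n as soon as G < (x - 1)^2, and x > 3 follows
    from this since G >= 4.  This is (i), and the other parts reduce to it by the
    growth of x in n.  Few pairs (q, n) are left, and the crude estimate settles
    them, except for g = q = 2 and n = 5 or 6.  There one only gets n B_n > 0, and
    concludes because n divides n B_n, which is an explicit polynomial in the
    integers a = x1 + x2 and b = x1 x2, where xi is the real number
    omega_i + conj omega_i. *)

Set Implicit Arguments.
Unset Strict Implicit.
Unset Printing Implicit Defensive.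

Import Order.TTheory GRing.Theory Num.Theory.
Local Open Scope ring_scope.

(** * Möbius sums over divisors, and the estimate behind (i) *)

Lemma norm_moebius_le1 n : `|moebius n| <= 1.
Proof.
by rewrite /moebius; case: ifP => _; rewrite ?normr0 // normrX normrN1 expr1n.
Qed.

Definition moebius_sum (R : pzRingType) (a : nat -> R) (n : nat) : R :=
  \sum_(d <- divisors n) (moebius (n %/ d))%:~R * a d.

(** Dropping the d with vanishing Möbius value matters in [sum_low_divisors_le]: for n = 12 and t =
    2^(1/4) all d <= 4 together would give sqrt 2 + 2 + 2 sqrt 2 + 4 > 8 = t^12. *)
Definition low_divisors (n : nat) : seq nat :=
  [seq d <- divisors n | (3 * d <= n)%N && (moebius (n %/ d) != 0)].

Ltac compute_moebius_sum :=
  rewrite /moebius_sum;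
  match goal with |- context [divisors ?n] =>
    let L := eval vm_compute in (divisors n) in
    have -> : divisors n = L by vm_compute
  end;
  rewrite !big_cons big_nil;
  repeat match goal with |- context [moebius ?n] =>
    let m := eval vm_compute in (moebius n) in
    have -> : moebius n = m by vm_compute
  end; ring.

Section MoebiusSums.
Variable R : realFieldType.
Implicit Types (a b : nat -> R) (t G c r : R).

Lemma moebius_sum_ge a b n : (0 < n)%N -> (forall d, `|a d| <= b d) ->
  a n - \sum_(d <- low_divisors n) b d - (if odd n then 0 else b n./2)
    <= moebius_sum a n.
Proof.
move=> n0 ab.
have b0 d : 0 <= b d by exact: le_trans (ab d).
have nn : n \in divisors n by rewrite -dvdn_divisors.
rewrite /moebius_sum [X in _ <= X](bigD1_seq n) ?divisors_uniq //=.
rewrite divnn n0 mul1r.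
rewrite -addrA lerD2l -opprD lerNl -sumrN.
(* The n/2 term becomes a sum over divisors too, so that both sides can be compared divisor by
   divisor. *)
have half : \sum_(d <- divisors n | (2 * d == n)%N) b d =
    if odd n then 0 else b n./2.
  case: ifPn => on.
    rewrite big1 // => d /eqP E.
    by move: on; rewrite -E oddM.
  have nh : n./2 \in divisors n.
    by rewrite -dvdn_divisors //; apply/dvdnP; exists 2%N; lia.
  have <- : \sum_(d <- [:: n./2]) b d = b n./2 by rewrite big_seq1.
  rewrite -(filter_pred1_uniq (divisors_uniq n) nh) big_filter.
  by apply: eq_bigl => d /=; lia.
rewrite -half big_filter [X in X <= _]big_mkcond [X in _ <= X + _]big_mkcond.
rewrite [X in _ <= _ + X]big_mkcond -big_split /=.
rewrite big_seq [X in _ <= X]big_seq; apply: ler_sum => d.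
rewrite -dvdn_divisors // => /dvdnP[k nk].
case: eqP => [_|/eqP dn] /=.
  by apply: addr_ge0; case: ifP.
have [->|mu0] := eqVneq (moebius (n %/ d)) 0.
  by rewrite mul0r oppr0 andbF add0r; case: ifP.
rewrite andbT; apply: (@le_trans _ _ (b d)).
  rewrite -mulNr; apply: le_trans (ler_norm _) _.
  rewrite normrM normrN; apply: le_trans (ab d).
  rewrite -intr_norm ler_piMl // ?normr_ge0 //.
  by rewrite -[X in _ <= X]/(1%:~R) ler_int norm_moebius_le1.
have [d0|d0] := leqP d 0; first by move: n0; rewrite nk; case: (d) d0 => //; rewrite muln0.
have k1 : (k != 1)%N by apply: contra dn => /eqP k1; rewrite nk k1 mul1n.
have [k2|k2] := eqVneq k 2%N.
  by rewrite nk k2 eqxx lerDr; case: ifP.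
have -> : (3 * d <= n)%N by rewrite nk leq_mul2r; apply/orP; right; lia.
by rewrite lerDl; case: ifP.
Qed.

(* The constant 13/11 is a lower bound for 2^(1/4), where the estimate on s below
   still holds. *)
Lemma sum_exp_le t m : 13 / 11 <= t ->
  \sum_(1 <= d < m.+1) t ^+ (2 * d) <= t ^+ (2 * m + 8).
Proof.
move=> t1; have t0 : 0 <= t by lra.
elim: m => [|m IH]; first by rewrite big_nil exprn_ge0.
rewrite big_nat_recr //=; apply: le_trans (_ : t ^+ (2 * m + 8) + t ^+ (2 * m.+1) <= _).
  by rewrite lerD2r.
have -> : (2 * m.+1 + 8 = 10 + 2 * m)%N by lia.
have -> : (2 * m.+1 = 2 + 2 * m)%N by lia.
rewrite [(2 * m + 8)%N]addnC (exprD t 8) (exprD t 2) (exprD t 10) -mulrDl.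
rewrite ler_wpM2r ?exprn_ge0 //.
(* Divided by t^(2m), the induction step reads s^4 + s <= s^5, that is 1 <= s^3 (s - 1). *)
set s := t ^+ 2.
have s1 : 169 / 121 <= s by rewrite /s expr2; nra.
rewrite -[8%N]/(2 * 4)%N -[10%N]/(2 * 5)%N !exprM -/s.
have s2 : (169 / 121) ^+ 3 <= s ^+ 3 by rewrite lerXn2r ?nnegrE //; lra.
have : 1 <= s ^+ 3 * (s - 1) by nra.
rewrite !exprS !expr0; nra.
Qed.

(* The bound is false for n = 6 and t = 2^(1/4); 9/7 is a lower bound for
   3^(1/4). For n > 21 (and n = 20) all d <= n/3 may be allowed; the smaller n
   are checked one by one, comparing each t^(2d) with t^n. *)
Lemma sum_low_divisors_le t n : 13 / 11 <= t -> (1 < n)%N ->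
  n != 6%N \/ 9 / 7 <= t ->
  \sum_(d <- low_divisors n) t ^+ (2 * d) <= t ^+ n.
Proof.
move=> t1 n1 n6; have t0 : 0 <= t by lra.
have [small|big] := leqP (2 * (n %/ 3) + 8) n.
  apply: le_trans (_ : t ^+ (2 * (n %/ 3) + 8) <= _); last first.
    by rewrite ler_weXn2l //; lra.
  apply: le_trans (sum_exp_le _ t1).
  have -> : \sum_(d <- low_divisors n) t ^+ (2 * d) =
      \sum_(1 <= d < (n %/ 3).+1 | d \in low_divisors n) t ^+ (2 * d).
    rewrite -[RHS]big_filter; apply: perm_big; apply: uniq_perm.
    - by rewrite filter_uniq ?divisors_uniq.
    - by rewrite filter_uniq ?iota_uniq.
    move=> d; rewrite !mem_filter mem_index_iota -dvdn_divisors; last by lia.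
    have [dn|//] := boolP (d %| n)%N; last by rewrite !andbF.
    have d0 : (0 < d)%N by apply: dvdn_gt0 dn; lia.
    rewrite ltnS leq_divRL // d0 mulnC !andbT.
    by case: (_ * _ <= _)%N; case: (_ != _).
  by rewrite [X in X <= _]big_mkcond ler_sum // => d _; case: ifP; rewrite ?exprn_ge0.
have tn0 : 0 <= t ^+ n by rewrite exprn_ge0.
have [n6'|n6'] := eqVneq n 6%N.
  (* With y = t^2 the claim is y + y^2 <= y^3, true once y reaches the golden ratio, which 81/49
     exceeds. *)
  rewrite n6' (_ : low_divisors 6 = [:: 1; 2]%N) ?big_cons ?big_nil; last by vm_compute.
  have {}n6 : 9 / 7 <= t by case: n6 => //; rewrite n6'.
  have y1 : 81 / 49 <= t ^+ 2 by rewrite expr2; nra.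
  by rewrite -[6%N]/(2 * 3)%N !exprM; nra.
have ratio k d : (k + 2 * d = n)%N -> t ^+ (2 * d) <= (11 / 13) ^+ k * t ^+ n.
  move=> <-; rewrite exprD mulrA -exprMn ler_peMl ?exprn_ge0 //.
  by rewrite exprn_ege1 //; lra.
case: n n1 big n6' n6 tn0 ratio => [|[|n]] //; do 20 try (case: n => [|n]); last by lia.
all: move=> _ _ n6 _ tn0 ratio; rewrite ?eqxx // in n6.
all: match goal with |- context [low_divisors ?n] =>
  let L := eval vm_compute in (low_divisors n) in
  have -> : low_divisors n = L by vm_compute end.
all: rewrite ?big_cons !big_nil.
all: match goal with
  | |- is_true (0 <= _) => by []
  | |- is_true (_ <= _ ^+ ?n) =>
    try (have r1 := ratio (n - 2)%N 1%N erefl);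
    try (have r2 := ratio (n - 4)%N 2%N erefl);
    try (have r3 := ratio (n - 6)%N 3%N erefl);
    try (have r4 := ratio (n - 8)%N 4%N erefl);
    try (have r5 := ratio (n - 10)%N 5%N erefl);
    try (have r6 := ratio (n - 12)%N 6%N erefl);
    try (have r7 := ratio (n - 14)%N 7%N erefl) end.
all: lra.
Qed.

Lemma ge_root4_2 t : 0 <= t -> 2 <= t ^+ 4 -> 13 / 11 <= t.
Proof.
move=> t0 t4; rewrite leNgt; apply/negP => lt.
have : t ^+ 4 <= (13 / 11) ^+ 4 by rewrite lerXn2r ?nnegrE //; lra.
lra.
Qed.

(** From 3 on, (n + 1)/n <= 4/3 <= r, so the left side grows by at most the factor r at each
    step. *)
Lemma linear_le_geometric c r m n : 0 <= c -> 4 / 3 <= r -> (3 <= m <= n)%N ->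
  c * m%:R <= r ^+ m -> c * n%:R <= r ^+ n.
Proof.
move=> c0 r1 /andP[m3 mn]; rewrite -(subnKC mn).
elim: (n - m)%N => [|k IH] cm; first by rewrite addn0.
rewrite addnS exprSr -natr1.
apply: le_trans (_ : (c * (m + k)%:R) * r <= _); last first.
  by rewrite ler_wpM2r ?IH //; lra.
have m3' : 3 <= (m + k)%:R :> R by rewrite ler_nat; lia.
rewrite -mulrA ler_wpM2l //; nra.
Qed.

(** Serves to bound n by 2 x^2, with r = t^2 >= sqrt 2 > 7/5. *)
Lemma le_double_geometric r n : 7 / 5 <= r -> n%:R <= 2 * r ^+ n.
Proof.
move=> r1.
have [n3|] := leqP 3 n.
  have : 1 / 2 * n%:R <= r ^+ n; last lra.
  apply: (@linear_le_geometric _ _ 3%N); rewrite ?n3 //; try lra.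
  have : (7 / 5) ^+ 3 <= r ^+ 3 by rewrite lerXn2r ?nnegrE //; lra.
  lra.
case: n => [|[|[|n]]] // _; rewrite ?expr0 ?expr1 ?expr2; nra.
Qed.

Lemma weil_sum_ge (q n : nat) t G (T : nat -> R) :
  (1 < q)%N -> 0 <= t -> t ^+ 4 = q%:R -> 4 <= G ->
  (forall d, `|T d| <= G * t ^+ (2 * d)) -> (1 < n)%N -> G < (t ^+ n - 1) ^+ 2 ->
  n%:R <= moebius_sum (fun d => q%:R ^+ d + 1 - T d) n.
Proof.
move=> q1 t0 t4 G4 Tle n1 Glt.
have t42 : 2 <= t ^+ 4 by rewrite t4 ler_nat.
have t1 := ge_root4_2 t0 t42.
pose b d := t ^+ (4 * d) + 1 + G * t ^+ (2 * d).
have ab d : `|q%:R ^+ d + 1 - T d| <= b d.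
  apply: le_trans (ler_normB _ _) _; rewrite lerD ?Tle //.
  by rewrite -t4 -exprM ger0_norm // addr_ge0 ?exprn_ge0.
apply: le_trans (moebius_sum_ge (ltnW n1) ab).
have Tn := Tle n; rewrite ler_norml in Tn; case/andP: Tn => _ Tn.
rewrite -t4 -exprM.
set x := t ^+ n in Glt.
have x1 : 1 <= x by rewrite exprn_ege1 //; lra.
have x3 : 3 < x by rewrite ltNge; apply/negP => x3; nra.
have ex2 : t ^+ (2 * n) = x ^+ 2 by rewrite mulnC exprM.
have ex4 : t ^+ (4 * n) = x ^+ 4 by rewrite mulnC exprM.
rewrite ex2 in Tn; rewrite ex4.
have n2 : n%:R <= 2 * x ^+ 2.
  by rewrite -ex2 exprM le_double_geometric // expr2; nra.
(* For q = 2 and n = 6, x^2 = t^12 = 8 would contradict x > 3; this rules out the exception in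
   [sum_low_divisors_le]. *)
have q3 : n = 6%N -> 3 <= t ^+ 4.
  move=> n6; rewrite t4 ler_nat ltn_neqAle q1 andbT; apply/eqP => q2.
  have : x ^+ 2 = 2 ^+ 3.
    by rewrite -ex2 n6 -[(2 * 6)%N]/(4 * 3)%N exprM t4 -q2.
  have : 9 < x ^+ 2 by nra.
  lra.
have n6 : n != 6%N \/ 9 / 7 <= t.
  have [n6|] := eqVneq n 6%N; [right|by left].
  rewrite leNgt; apply/negP => lt; have := q3 n6.
  have : t ^+ 4 <= (9 / 7) ^+ 4 by rewrite lerXn2r ?nnegrE //; lra.
  lra.
(* For d <= n/3, y = t^(2d) lies between 1 and x, so [b d] = y^2 + 1 + G y <= (x + 1 + G) y. *)
have low : \sum_(d <- low_divisors n) b d <= (x + 1 + G) * x.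
  apply: le_trans (_ : \sum_(d <- low_divisors n) (x + 1 + G) * t ^+ (2 * d) <= _).
    rewrite big_seq [X in _ <= X]big_seq; apply: ler_sum => d.
    rewrite mem_filter => /andP[/andP[dn _] _].
    have y1 : 1 <= t ^+ (2 * d) by rewrite exprn_ege1 //; lra.
    have yx : t ^+ (2 * d) <= x by rewrite ler_weXn2l //; [lra | clear -dn; lia].
    rewrite /b (_ : t ^+ (4 * d) = (t ^+ (2 * d)) ^+ 2); last first.
      by rewrite -exprM mulnAC.
    nra.
  by rewrite -mulr_sumr ler_wpM2l ?sum_low_divisors_le //; lra.
(* For n odd, the terms in G total G (x^2 + x) <= (x - 1)^2 (x^2 + x). This leaves x^3 - 2 x + 1,
   which exceeds 2 x^2 >= n because x > 3. *)
case: ifPn => on.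
  have e : (x - 1) ^+ 2 * (x ^+ 2 + x) = x ^+ 4 - x ^+ 3 - x ^+ 2 + x by ring.
  have : G * (x ^+ 2 + x) <= x ^+ 4 - x ^+ 3 - x ^+ 2 + x.
    by rewrite -e ler_wpM2r ?ltW //; nra.
  have : 0 <= x * (x - 3) * (x + 1) by rewrite !mulr_ge0 //; lra.
  nra.
have bh : b n./2 = x ^+ 2 + 1 + G * x.
  have n2h : (2 * n./2 = n)%N by clear -on; lia.
  by rewrite /b -(mulnA 2 2) n2h ex2.
rewrite bh.
have [l0|l0] := eqVneq (low_divisors n) [::].
  have e : (x - 1) ^+ 2 * (x ^+ 2 + x) = x ^+ 4 - x ^+ 3 - x ^+ 2 + x by ring.
  have : G * (x ^+ 2 + x) <= x ^+ 4 - x ^+ 3 - x ^+ 2 + x.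
    by rewrite -e ler_wpM2r ?ltW //; nra.
  rewrite l0 big_nil.
  have : 0 <= x * (x - 3) * (x + 1) by rewrite !mulr_ge0 //; lra.
  nra.
(* With both n/2 and low divisors present, the same estimate leaves only x^2 - 3 x. For x >= 5 this
   is at least 2/5 x^2, hence the factor 5/2. *)
have [nx x25] : 5 / 2 * n%:R <= x ^+ 2 /\ 25 <= x ^+ 2.
  have [n10|n10] := leqP 10 n.
    have nx : 5 / 2 * n%:R <= x ^+ 2.
      rewrite -ex2 exprM; apply: (@linear_le_geometric _ _ 10); rewrite ?n10 //; try lra.
        by rewrite expr2; nra.
      have : 2 ^+ 5 <= (t ^+ 4) ^+ 5 by rewrite lerXn2r ?nnegrE //; lra.
      by rewrite -!exprM; lra.
    split=> //; have : 10 <= n%:R :> R by rewrite ler_nat.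
    lra.
  (* Among even n < 10 only 6 has low divisors; there x^2 = q^3 >= 27. *)
  have n6' : n = 6%N.
    case: (n) n1 on l0 n10; by do 10 try case=> //.
  have : 3 ^+ 3 <= (t ^+ 4) ^+ 3 by rewrite lerXn2r ?nnegrE ?q3 //; lra.
  by rewrite -ex2 -exprM n6'; lra.
have x5 : 5 <= x by nra.
have e : (x - 1) ^+ 2 * (x ^+ 2 + 2 * x) = x ^+ 4 - 3 * x ^+ 2 + 2 * x by ring.
have : G * (x ^+ 2 + 2 * x) <= x ^+ 4 - 3 * x ^+ 2 + 2 * x.
  by rewrite -e ler_wpM2r ?ltW //; nra.
nra.
Qed.

Lemma moebius_sum2 a : moebius_sum a 2 = a 2%N - a 1%N.
Proof. by compute_moebius_sum. Qed.

Lemma moebius_sum4 a : moebius_sum a 4 = a 4%N - a 2%N.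
Proof. by compute_moebius_sum. Qed.

Lemma moebius_sum5 a : moebius_sum a 5 = a 5%N - a 1%N.
Proof. by compute_moebius_sum. Qed.

Lemma moebius_sum6 a : moebius_sum a 6 = a 6%N - a 3%N - a 2%N + a 1%N.
Proof. by compute_moebius_sum. Qed.

Lemma moebius_sum7 a : moebius_sum a 7 = a 7%N - a 1%N.
Proof. by compute_moebius_sum. Qed.

(** A step n -> n + 1 multiplies the left side by at most 4/3 <= t^2, and the right side by at least
    t^2 since t (x - 1) <= t x - 1. *)
Lemma linear_lt_sqr_geometric c t m n : 0 <= c -> 13 / 11 <= t -> (3 <= m <= n)%N ->
  c * m%:R < (t ^+ m - 1) ^+ 2 -> c * n%:R < (t ^+ n - 1) ^+ 2.
Proof.
move=> c0 t1 /andP[m3 mn]; rewrite -(subnKC mn).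
elim: (n - m)%N => [|k IH] cm; first by rewrite addn0.
rewrite addnS (exprS t) -natr1.
have {}IH := IH cm.
have x1 : 1 <= t ^+ (m + k) by rewrite exprn_ege1 //; lra.
have k3 : 3 <= (m + k)%:R :> R by rewrite ler_nat; lia.
set x := t ^+ (m + k) in IH x1 *; set s := (m + k)%:R in IH k3 *.
apply: le_lt_trans (_ : t ^+ 2 * (c * s) < _).
  have t2 : 4 / 3 <= t ^+ 2 by rewrite expr2; nra.
  by rewrite mulrCA ler_wpM2l //; nra.
apply: lt_le_trans (_ : t ^+ 2 * (x - 1) ^+ 2 <= _).
  by rewrite ltr_pM2l // exprn_gt0 //; lra.
have tx : 0 <= t * (x - 1) by rewrite mulr_ge0 //; lra.
by rewrite -exprMn lerXn2r ?nnegrE //; lra.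
Qed.

End MoebiusSums.

(** * Integrality of B_5 and B_6 for surfaces over F_2 *)

(* For a surface over F_2 with real traces x1, x2, put a = x1 + x2 and b = x1 x2:
   these are 5 B_5 and 6 B_6. *)
Definition surface_poly5 (R : pzRingType) (a b : R) : R :=
  30 - (a ^+ 5 - 5 * a ^+ 3 * b + 5 * a * b ^+ 2
        - 10 * (a ^+ 3 - 3 * a * b) + 19 * a).

Definition surface_poly6 (R : pzRingType) (a b : R) : R :=
  54 - (a ^+ 6 - 6 * a ^+ 4 * b + 9 * a ^+ 2 * b ^+ 2 - 2 * b ^+ 3
        - 12 * (a ^+ 4 - 4 * a ^+ 2 * b + 2 * b ^+ 2)
        - (a ^+ 3 - 3 * a * b) + 35 * (a ^+ 2 - 2 * b) + 7 * a - 24).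

Lemma intr_surface_poly5 (R : comNzRingType) (a b : int) :
  (surface_poly5 a b)%:~R = surface_poly5 a%:~R b%:~R :> R.
Proof. by rewrite /surface_poly5; ring. Qed.

Lemma intr_surface_poly6 (R : comNzRingType) (a b : int) :
  (surface_poly6 a b)%:~R = surface_poly6 a%:~R b%:~R :> R.
Proof. by rewrite /surface_poly6; ring. Qed.

(** The polynomial is reduced modulo 5 and evaluated at all 25 pairs of residues. *)
Lemma dvd5_surface_poly (a b : int) : (5 %| surface_poly5 a b)%Z.
Proof.
rewrite (@dvdz_pcharf 'F_5) ?pchar_Fp // intr_surface_poly5.
move: (a%:~R) (b%:~R) => u v.
by apply/eqP; case: u => [[|[|[|[|[|u]]]]] //] ?;
  case: v => [[|[|[|[|[|v]]]]] //] ?; apply/val_inj; vm_compute.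
Qed.

Lemma dvd6_surface_poly (a b : int) : (6 %| surface_poly6 a b)%Z.
Proof.
rewrite (@Gauss_dvdz 2 3) //; apply/andP; split.
  rewrite (@dvdz_pcharf 'F_2) ?pchar_Fp // intr_surface_poly6.
  move: (a%:~R) (b%:~R) => u v.
  by apply/eqP; case: u => [[|[|u]] //] ?; case: v => [[|[|v]] //] ?;
    apply/val_inj; vm_compute.
rewrite (@dvdz_pcharf 'F_3) ?pchar_Fp // intr_surface_poly6.
move: (a%:~R) (b%:~R) => u v.
by apply/eqP; case: u => [[|[|[|u]]] //] ?; case: v => [[|[|[|v]]] //] ?;
  apply/val_inj; vm_compute.
Qed.

(** * Lower bounds for (ii), (iii) and (iv) *)

Section Weil.
Variables (R : realFieldType) (q g : nat) (t : R) (T : nat -> R).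
Hypotheses (q1 : (1 < q)%N) (g2 : (2 <= g)%N) (t0 : 0 <= t) (t4 : t ^+ 4 = q%:R).
Hypothesis Tle : forall d, `|T d| <= (2 * g)%:R * t ^+ (2 * d).

Let S := moebius_sum (fun d => q%:R ^+ d + 1 - T d).
Let G : R := (2 * g)%:R.

Let G4 : 4 <= G. Proof. by rewrite (ler_nat _ 4) (leq_mul2l 2 2) g2. Qed.

Let t1 : 13 / 11 <= t.
Proof. by apply: ge_root4_2 => //; rewrite t4 ler_nat. Qed.

Let exp4 k : t ^+ (4 * k) = q%:R ^+ k. Proof. by rewrite exprM t4. Qed.

Let trace_bounds d : - (G * t ^+ (2 * d)) <= - T d <= G * t ^+ (2 * d).
Proof. by rewrite -ler_norml normrN. Qed.

Lemma ge_root4 c m : 0 <= c -> c ^+ 4 <= m%:R -> (m <= q)%N -> c <= t.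
Proof.
move=> c0 cm mq; rewrite leNgt; apply/negP => lt.
have : t ^+ 4 < c ^+ 4 by rewrite ltrXn2r.
by rewrite t4 ltNge (le_trans cm) // ler_nat.
Qed.

(** In (iii) and (iv) G is at most linear in n, so the criterion of (i) need only be checked at the
    least n. *)
Lemma weil_sum_ge_geometric c m n : G <= c * n%:R -> 0 <= c -> (3 <= m <= n)%N ->
  c * m%:R < (t ^+ m - 1) ^+ 2 -> n%:R <= S n.
Proof.
move=> Gn c0 mn cm; apply: (weil_sum_ge q1 t0 t4 G4 Tle); first by clear -mn; lia.
by apply: le_lt_trans Gn _; apply: (@linear_lt_sqr_geometric _ _ _ m).
Qed.

(** The crude bound q^2 - q - G (q + sqrt q) factors, and the hypothesis of (ii) says that its
    second factor is nonnegative. *)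
Lemma weil_sum2_ge : (t ^+ 4 + t ^+ 2) * (t ^+ 4 - t ^+ 2 - G) <= S 2.
Proof.
rewrite /S moebius_sum2 -!exp4.
have := trace_bounds 2; have := trace_bounds 1; rewrite -[(2 * 2)%N]/4%N -[(2 * 1)%N]/2%N.
rewrite -[(4 * 2)%N]/8%N -[(4 * 1)%N]/4%N => /andP[_ h1] /andP[h2 _].
have -> : (t ^+ 4 + t ^+ 2) * (t ^+ 4 - t ^+ 2 - G) =
  t ^+ 8 - t ^+ 4 - G * t ^+ 4 - G * t ^+ 2 by ring.
lra.
Qed.

Lemma weil_sum_ge0 n : (1 < n)%N -> G <= q%:R - t ^+ 2 -> 0 <= S n.
Proof.
rewrite -t4 => n1 Gq; have y0 : 0 <= t ^+ 2 by rewrite exprn_ge0.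
have [->|n2] := eqVneq n 2%N.
  by apply: le_trans weil_sum2_ge; apply: mulr_ge0; [rewrite addr_ge0 ?exprn_ge0 | lra].
apply: le_trans (_ : n%:R <= _); first by rewrite ler0n.
apply: (weil_sum_ge q1 t0 t4 G4 Tle) => //.
(* For n >= 3 it suffices that t^2 + 1 <= t^3, since then (t^n - 1)^2 >= t^4 = q > G. As G >= 4, the
   hypothesis forces t^2 >= 5/2. *)
rewrite (exprM t 2 2) in Gq.
have y2 : 5 / 2 <= t ^+ 2 by have := G4; nra.
have t15 : 3 / 2 <= t by rewrite -(@ler_pXn2r _ 2) ?nnegrE //; lra.
have : t ^+ 3 <= t ^+ n by rewrite ler_weXn2l //; [lra | clear -n1 n2; lia].
have : t ^+ 2 + 1 <= t ^+ 3 by rewrite (exprS t 2); nra.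
move=> h1 h2; apply: lt_le_trans (_ : (t ^+ 2) ^+ 2 <= _); first by lra.
by rewrite lerXn2r ?nnegrE //; lra.
Qed.

Lemma weil_sum_ge_genus n : (1 < n)%N -> q != 6%N -> (g <= n)%N ->
  ~~ ((g <= 9) && (q <= 5))%N -> n%:R <= S n.
Proof.
move=> n1 q6 gn exc.
have G2n : G <= 2 * n%:R by rewrite -natrM ler_nat leq_mul2l.
have y2 : 0 <= t ^+ 2 by rewrite exprn_ge0.
have [n10|n10] := leqP 10 n.
  apply: (@weil_sum_ge_geometric 2 10) => //.
  have : 2 ^+ 5 <= (t ^+ 4) ^+ 5 by rewrite lerXn2r ?nnegrE ?exprn_ge0 // t4 (ler_nat _ 2).
  rewrite -exprM (exprM t 10 2) => h; have x0 : 0 <= t ^+ 10 by rewrite exprn_ge0.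
  by nra.
(* Here g <= n <= 9, so the excluded cases leave q > 5. *)
have q7 : (7 <= q)%N by clear -q6 gn exc n10; lia.
have q7' : 7 <= (t ^+ 2) ^+ 2 by rewrite -exprM t4 (ler_nat _ 7).
have y26 : 13 / 5 <= t ^+ 2 by nra.
(* For n = g = 2 the criterion of (i) would require q > 9, so the direct bound is used. *)
have [n2|n2] := eqVneq n 2%N.
  have g2' : G = 4 by rewrite /G (_ : g = 2%N) //; clear -gn n2 g2; lia.
  rewrite n2; apply: le_trans weil_sum2_ge; rewrite g2' (exprM t 2 2); nra.
apply: (@weil_sum_ge_geometric 2 3); rewrite ?ler0n //; first by clear -n1 n2; lia.
have : 8 / 5 <= t by apply: (@ge_root4 _ 7) => //; lra.
move=> t16; have : (8 / 5) ^+ 3 <= t ^+ 3 by rewrite lerXn2r ?nnegrE //; lra.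
by move=> h; nra.
Qed.

Lemma weil_sum_ge_double_genus n : (2 * g <= n)%N -> ~~ ((g <= 3) && (q == 2))%N ->
  n%:R <= S n.
Proof.
move=> gn exc.
have Gn : G <= 1 * n%:R by rewrite mul1r ler_nat.
(* [c] is a lower bound for t^m, tested without roots through its fourth power. *)
have base (c : R) m : (3 <= m <= n)%N -> 1 <= c -> c ^+ 4 <= q%:R ^+ m ->
    m%:R < (c - 1) ^+ 2 -> n%:R <= S n.
  move=> mn c1 cq mc; apply: (weil_sum_ge_geometric Gn ler01 mn).
  rewrite mul1r; apply: lt_le_trans mc _.
  have : c <= t ^+ m.
    rewrite -(@ler_pXn2r _ 4) ?nnegrE ?exprn_ge0 //; last by lra.
    by rewrite -exprM mulnC exp4.
  by move=> h; rewrite lerXn2r ?nnegrE //; lra.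
have [q2|q2] := eqVneq q 2%N.
  apply: (base 4 8%N); rewrite ?q2; try lra.
  by clear -gn exc q2; lia.
have [q3|q3] := eqVneq q 3%N; last first.
  apply: (base 4 4%N); try lra; first by clear -gn g2; lia.
  by rewrite lerXn2r ?nnegrE ?ler0n // (ler_nat _ 4); clear -q1 q2 q3; lia.
(* At q = 3, n = 4 the criterion of (i) just fails: (t^4 - 1)^2 = 4 = G. *)
have [n4|n4] := eqVneq n 4%N; last first.
  apply: (base (39 / 10) 5%N); rewrite ?q3; try lra.
  by clear -gn g2 n4; lia.
have G4' : G = 4 by rewrite /G (_ : g = 2%N) //; clear -gn n4 g2; lia.
have := trace_bounds 4; have := trace_bounds 2; rewrite (exp4 1) (exp4 2) G4' q3 expr1.
by rewrite n4 /S moebius_sum4 q3 => /andP[h1 h2] /andP[h3 h4]; lra.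
Qed.

Lemma weil_sum_ge_binary n : q = 2%N -> (g <= 3)%N -> (2 * g + 1 <= n)%N ->
  n%:R <= S n \/ g = 2%N /\ (n = 5%N \/ n = 6%N).
Proof.
move=> q2 g3 gn; have y2 : (t ^+ 2) ^+ 2 = 2 by rewrite -exprM t4 q2.
have y1 : t ^+ 2 <= 3 / 2.
  by rewrite -(@ler_pXn2r _ 2) ?nnegrE ?exprn_ge0 ?y2 //; lra.
have [n8|n8] := leqP 8 n.
  left; apply: (@weil_sum_ge_geometric 1 8) => //.
    by rewrite mul1r ler_nat; clear -gn; lia.
  by rewrite (exp4 2) q2; lra.
have [n7|n7] := eqVneq n 7%N; last by right; clear -g2 g3 gn n8 n7; lia.
left; have G6 : G <= 6 by rewrite (ler_nat _ _ 6) (leq_mul2l 2 g 3).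
have Gy : G * t ^+ 2 <= 6 * (3 / 2) by rewrite ler_pM // ?exprn_ge0 // ler0n.
have := trace_bounds 7; have := trace_bounds 1; rewrite -[(2 * 7)%N]/(2 * (2 * 3) + 2)%N.
rewrite exprD [t ^+ (2 * (2 * 3))]exprM [(t ^+ 2) ^+ (2 * 3)]exprM y2.
by rewrite n7 /S moebius_sum7 q2 => /andP[h1 h2] /andP[h3 h4]; lra.
Qed.

(** The crude bound is 30 - 4 (t^10 + t^2) = 30 - 20 sqrt 2, positive but less than 5. *)
Lemma weil_sum5_gt0 : q = 2%N -> g = 2%N -> 0 < S 5.
Proof.
move=> q2 g2'; have y2 : (t ^+ 2) ^+ 2 = 2 by rewrite -exprM t4 q2.
have y1 : t ^+ 2 < 3 / 2.
  by rewrite -(@ltr_pXn2r _ 2) ?nnegrE ?exprn_ge0 ?y2 //; lra.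
have := trace_bounds 5; have := trace_bounds 1; rewrite -[(2 * 5)%N]/(2 * (2 * 2) + 2)%N /G g2'.
rewrite exprD [t ^+ (2 * (2 * 2))]exprM [(t ^+ 2) ^+ (2 * 2)]exprM y2.
by rewrite /S moebius_sum5 q2 => /andP[h1 h2] /andP[h3 h4]; lra.
Qed.

End Weil.

(** The left side is the share of one conjugate pair in T 6 - T 3 - T 2 + T 1, and 6 B_6 is 54 minus
    two such shares. Bounding the four traces separately would give 4 (10 + 3 sqrt 2) > 54. *)
Lemma trace_sum6_lt (R : realFieldType) (x : R) : x ^+ 2 <= 8 ->
  x ^+ 6 - 12 * x ^+ 4 + 36 * x ^+ 2 - 16 - (x ^+ 3 - 6 * x) - (x ^+ 2 - 4) + x < 27.
Proof.
move=> x8; set u := x ^+ 3 - 6 * x.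
(* With x = 2 sqrt 2 cos z, u is 4 sqrt 2 cos (3 z), so that u^2 <= 32. *)
have : 0 <= (8 - x ^+ 2) * (x ^+ 2 - 2) ^+ 2 by rewrite mulr_ge0 ?sqr_ge0 // subr_ge0.
have -> : (8 - x ^+ 2) * (x ^+ 2 - 2) ^+ 2 = 32 - u ^+ 2 by rewrite /u; ring.
have -> : x ^+ 6 - 12 * x ^+ 4 + 36 * x ^+ 2 - 16 = u ^+ 2 - 16 by rewrite /u; ring.
(* The sum is at most 32 - 16 + 6 + 4 + (x - x^2), and x - x^2 <= 1/4. *)
move=> u32; have u6 : - u <= 6 by nra.
have : 0 <= (x - 1 / 2) ^+ 2 by rewrite sqr_ge0.
lra.
Qed.

Lemma card_finField_neq6 (F : finFieldType) : #|F| != 6%N.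
Proof.
have [p pr_p charFp] := finPcharP F.
apply/eqP => F6; have := card_pprimeChar charFp.
rewrite [#|_|]F6 => E.
have : (p %| 6)%N.
  by rewrite E dvdn_exp //; case: logn E.
rewrite (Euclid_dvdM 2 3) // !dvdn_prime2 // => /orP[] /eqP p_eq.
  by move: E; rewrite p_eq.
by move: E; rewrite p_eq.
Qed.

(** * Real traces of the powers of Frobenius *)

Section Traces.
Variables (R : realType) (q g : nat) (omega : 'I_g -> R[i]).
Hypothesis omega_norm : forall i, `|omega i| = (Num.sqrt q%:R)%:C%C.

(** The sum is already real; taking its real part moves the estimates from [R[i]] to [R]. *)
Definition power_trace d : R :=
  complex.Re (\sum_(i < g) (omega i ^+ d + (omega i)^* ^+ d)).

Lemma power_traceE d :
  (power_trace d)%:C%C = \sum_(i < g) (omega i ^+ d + (omega i)^* ^+ d).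
Proof.
rewrite RRe_real //; apply: rpred_sum => i _.
by rewrite CrealE rmorphD /= !rmorphXn /= conjCK addrC.
Qed.

Lemma power_trace_le d : `|power_trace d| <= (2 * g)%:R * Num.sqrt q%:R ^+ d.
Proof.
rewrite -lecR; apply: le_trans (normc_ge_Re _) _.
apply: le_trans (ler_norm_sum _ _ _) _.
apply: le_trans (_ : \sum_(i < g) (Num.sqrt q%:R ^+ d *+ 2)%:C%C <= _).
  apply: ler_sum => i _; apply: le_trans (ler_normD _ _) _.
  by rewrite !normrX norm_conjC omega_norm -!rmorphXn mulr2n rmorphD.
by rewrite sumr_const card_ord -rmorphMn lecR -mulrnA -[_ *+ (2 * g)]mulr_natl.
Qed.

Lemma BE n : B q omega n =
  (moebius_sum (fun d => q%:R ^+ d + 1 - power_trace d) n / n%:R)%:C%C.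
Proof.
rewrite /B mulrC rmorphM fmorphV rmorph_nat; congr (_ * _).
rewrite rmorph_sum; apply: eq_bigr => d _.
rewrite /N -power_traceE; move: (power_trace d) => T.
by rewrite rmorphM rmorph_int rmorphB rmorphD rmorph1 rmorphXn rmorph_nat.
Qed.

End Traces.

(** * Surfaces over F_2 with n = 5 or 6 *)

(** With x = omega + conj omega and omega conj omega = 2, the power sums of a conjugate pair are the
    Dickson polynomials in x with parameter 2. *)
Lemma binary_surface_traces (R : realType) (f : {poly int}) (omega : 'I_2 -> R[i]) :
  weil_roots 2 f omega ->
  exists (x y : R) (a b : int),
    [/\ x + y = a%:~R, x * y = b%:~R, x ^+ 2 <= 8, y ^+ 2 <= 8 &
    [/\ power_trace omega 1 = x + y,
        power_trace omega 2 = x ^+ 2 - 4 + (y ^+ 2 - 4),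
        power_trace omega 3 = x ^+ 3 - 6 * x + (y ^+ 3 - 6 * y),
        power_trace omega 5 = x ^+ 5 - 10 * x ^+ 3 + 20 * x + (y ^+ 5 - 10 * y ^+ 3 + 20 * y) &
        power_trace omega 6 = x ^+ 6 - 12 * x ^+ 4 + 36 * x ^+ 2 - 16
                              + (y ^+ 6 - 12 * y ^+ 4 + 36 * y ^+ 2 - 16)]].
Proof.
case=> fE om.
have [x xE x8] : exists2 x : 'I_2 -> R, forall i, (x i)%:C%C = omega i + (omega i)^* &
    forall i, x i ^+ 2 <= 8.
  exists (fun i => complex.Re (omega i + (omega i)^*)) => i.
    by rewrite RRe_real // CrealE rmorphD /= conjCK addrC.
  have : `|complex.Re (omega i + (omega i)^*)| <= 2 * Num.sqrt 2.
    rewrite -lecR; apply: le_trans (normc_ge_Re _) _.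
    apply: le_trans (ler_normD _ _) _.
    by rewrite norm_conjC om -rmorphD lecR mulr2n mulrDl mul1r.
  rewrite -[_ ^+ 2]real_normK ?num_real // => le.
  have -> : 8 = (2 * Num.sqrt 2) ^+ 2 :> R by rewrite exprMn sqr_sqrtr ?ler0n //; ring.
  by rewrite lerXn2r ?nnegrE ?mulr_ge0 ?sqrtr_ge0 ?ler0n.
have prod i : omega i * (omega i)^* = 2.
  by rewrite -normCK om -rmorphXn sqr_sqrtr ?ler0n // rmorph_nat.
pose i1 : 'I_2 := lift ord0 ord0.
have traceE d (p : R -> R) :
    (forall i, omega i ^+ d + (omega i)^* ^+ d = (p (x i))%:C%C) ->
    power_trace omega d = p (x ord0) + p (x i1).
  move=> pE; apply: complexI; rewrite power_traceE !big_ord_recl big_ord0 addr0 !pE.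
  by rewrite rmorphD.
have {}fE : map_poly intr f = 'X^4 - (x ord0 + x i1)%:C%C%:P * 'X^3
    + (x ord0 * x i1 + 4)%:C%C%:P * 'X^2 - (2 * (x ord0 + x i1))%:C%C%:P * 'X + 4%:P.
  rewrite fE !big_ord_recl big_ord0 mulr1 -/i1.
  have factor i : ('X - (omega i)%:P) * ('X - ((omega i)^*)%:P) = 'X^2 - (x i)%:C%C%:P * 'X + 2%:P.
    by rewrite xE -(prod i) polyCD polyCM; ring.
  rewrite !factor !(rmorphD, rmorphM) /=.
  ring.
have coef k := congr1 (fun p : {poly R[i]} => p`_k) fE.
(* Integrality of a and b comes from f = X^4 - a X^3 + (b + 4) X^2 - 2 a X + 4. *)
exists (x ord0), (x i1), (- f`_3), (f`_2 - 4); split=> //.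
- apply: complexI; have := coef 3%N; rewrite coef_map /= !coefE /= => c3.
  by rewrite rmorph_int rmorphN /= c3; ring.
- apply: complexI; have := coef 2%N; rewrite coef_map /= !coefE /= => c2.
  by rewrite rmorph_int rmorphB /= c2 !(rmorphD, rmorphM) /=; ring.
split.
- by rewrite (traceE 1%N id) // => i; rewrite xE !expr1.
- rewrite (traceE 2%N (fun x => x ^+ 2 - 4)) // => i.
  rewrite /= !(rmorphB, rmorphD, rmorphXn, rmorphM) /= xE; have e := prod i; ring: e.
- rewrite (traceE 3%N (fun x => x ^+ 3 - 6 * x)) // => i.
  rewrite /= !(rmorphB, rmorphD, rmorphXn, rmorphM) /= xE; have e := prod i; ring: e.
- rewrite (traceE 5%N (fun x => x ^+ 5 - 10 * x ^+ 3 + 20 * x)) // => i.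
  rewrite /= !(rmorphB, rmorphD, rmorphXn, rmorphM) /= xE; have e := prod i; ring: e.
- rewrite (traceE 6%N (fun x => x ^+ 6 - 12 * x ^+ 4 + 36 * x ^+ 2 - 16)) // => i.
  rewrite /= !(rmorphB, rmorphD, rmorphXn, rmorphM) /= xE; have e := prod i; ring: e.
Qed.

Lemma dvdz_intr_ge (R : realDomainType) (m : nat) (z : int) :
  (m %| z)%Z -> 0 < z%:~R :> R -> m%:R <= z%:~R :> R.
Proof.
rewrite ltr0z => dmz z0; rewrite -[m%:R]/(m%:Z%:~R) ler_int.
by rewrite -(gtz0_abs z0) lez_nat dvdn_leq // absz_gt0 gt_eqF.
Qed.

Lemma binary_surface5_ge (R : realType) (f : {poly int}) (omega : 'I_2 -> R[i]) :
  weil_roots 2 f omega ->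
  let S := moebius_sum (fun d => 2 ^+ d + 1 - power_trace omega d) in
  0 < S 5 -> 5 <= S 5.
Proof.
move=> om S; have [x [y [a [b [xya xyb _ _ [T1 _ _ T5 _]]]]]] := binary_surface_traces om.
have -> : S 5%N = (surface_poly5 a b)%:~R.
  by rewrite intr_surface_poly5 -xya -xyb /S moebius_sum5 T1 T5 /surface_poly5; ring.
exact/dvdz_intr_ge/dvd5_surface_poly.
Qed.

Lemma binary_surface6_ge (R : realType) (f : {poly int}) (omega : 'I_2 -> R[i]) :
  weil_roots 2 f omega ->
  6 <= moebius_sum (fun d => 2 ^+ d + 1 - power_trace omega d) 6.
Proof.
move=> om.
have [x [y [a [b [xya xyb x8 y8 [T1 T2 T3 _ T6]]]]]] := binary_surface_traces om.
rewrite moebius_sum6 T1 T2 T3 T6.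
have := trace_sum6_lt x8; have := trace_sum6_lt y8.
set X := (X in _ <= X); move=> hx hy.
have : 0 < X by rewrite /X; lra.
have -> : X = (surface_poly6 a b)%:~R.
  by rewrite intr_surface_poly6 -xya -xyb /X /surface_poly6; ring.
exact/dvdz_intr_ge/dvd6_surface_poly.
Qed.

(** * The threshold of (i), and the assembly of the four parts *)

(** Both sides say 1 + sqrt G < Q^(n/4): one after taking logarithms, the other after squaring, as
    Q^(n/4) >= 1. *)
Lemma threshold_equiv (R : realType) (Q G : R) (n : nat) : 1 < Q -> 0 <= G ->
  4 * (ln (1 + G `^ (1 / 2)) / ln Q) < n%:R <-> G < (Q `^ (n%:R / 4) - 1) ^+ 2.
Proof.
move=> Q1 G0; have lnQ : 0 < ln Q by rewrite ln_gt0.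
have Q0 : 0 < Q by lra.
have -> : G `^ (1 / 2) = Num.sqrt G by rewrite div1r powR12_sqrt.
have s0 := sqrtr_ge0 G.
have x0 : 0 < Q `^ (n%:R / 4) by rewrite powR_gt0.
have x1 : 1 <= Q `^ (n%:R / 4).
  rewrite -[X in X <= _](powRr0 Q); apply: ler_powR; first exact: ltW.
  by rewrite divr_ge0 ?ler0n.
have -> : (4 * (ln (1 + Num.sqrt G) / ln Q) < n%:R) = (1 + Num.sqrt G < Q `^ (n%:R / 4)).
  rewrite -[RHS]ltr_ln ?posrE //; last by lra.
  by rewrite ln_powR mulrA ltr_pdivrMr // [n%:R / 4 * _]mulrAC ltr_pdivlMr // mulrC.
have -> : (1 + Num.sqrt G < Q `^ (n%:R / 4)) = (Num.sqrt G < Q `^ (n%:R / 4) - 1) by rewrite ltrBrDl.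
by rewrite -{2}(sqr_sqrtr G0) ltr_pXn2r ?nnegrE // subr_ge0.
Qed.

Theorem proposition3p8 (R : realType)
  (F : finFieldType) (K : closedFieldType) (iota : {rmorphism F -> K})
  (algK : forall x : K, algebraicOver iota x)
  (A : abelian_variety iota) (g : nat) (dimA : krull_dim (@av_coord _ _ _ A) g)
  (f : {poly int}) (fA : weil_polynomial A g f)
  (omega : 'I_g -> R[i]) (omegaA : weil_roots #|F| f omega)
  (n : nat) (g_ge2 : (2 <= g)%N) (n_ge2 : (2 <= n)%N) :
  let q := #|F| in
  let Bn := B q omega n in
  let Q : R := q%:R in
  [/\ (* (i) *)
      (4 * (ln (1 + (2 * g%:R) `^ (1 / 2)) / ln Q) < n%:R <->
         g%:R < (Q `^ (n%:R / 4) - 1) ^+ 2 / 2) /\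
      (4 * (ln (1 + (2 * g%:R) `^ (1 / 2)) / ln Q) < n%:R -> 1 <= Bn),
      (* (ii) *)
      g%:R <= (Q - Q `^ (1 / 2)) / 2 -> 0 <= Bn,
      (* (iii) *)
      (g <= n)%N -> ~ ((2 <= g <= 9)%N /\ (q <= 5)%N) -> 1 <= Bn
    & (* (iv) *)
      ((2 * g <= n)%N -> ~ ((2 <= g <= 3)%N /\ q = 2%N) -> 1 <= Bn) /\
      ((2 <= g <= 3)%N -> q = 2%N -> (2 * g + 1 <= n)%N -> 1 <= Bn)].
Proof.
move=> q Bn Q; case: (omegaA) => _ omega_norm.
have q1 : (1 < q)%N by exact: card_finNzRing_gt1.
have Q1 : 1 < Q by rewrite (ltr_nat _ 1).
have Q0 : 0 <= Q by rewrite ler0n.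
pose t := Q `^ 4^-1.
have t0 : 0 <= t by rewrite powR_ge0.
have texp m : t ^+ m = Q `^ (m%:R / 4).
  by rewrite -powR_mulrn // -powRrM mulrC.
have t4 : t ^+ 4 = q%:R by rewrite texp divff ?powRr1 // pnatr_eq0.
have t2 : t ^+ 2 = Num.sqrt Q.
  by rewrite texp -powR12_sqrt //; congr (_ `^ _); field.
have t2' : t ^+ 2 = Q `^ (1 / 2) by rewrite t2 div1r powR12_sqrt.
have Tle d : `|power_trace omega d| <= (2 * g)%:R * t ^+ (2 * d).
  by rewrite exprM t2; apply: power_trace_le.
pose S := moebius_sum (fun d => q%:R ^+ d + 1 - power_trace omega d).
have n0 : 0 < n%:R :> R by rewrite ltr0n ltnW.
have B_ge1 : n%:R <= S n -> 1 <= Bn.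
  by move=> h; rewrite /Bn BE -[1]/(1%:C)%C lecR ler_pdivlMr // mul1r.
have B_ge0 : 0 <= S n -> 0 <= Bn.
  by move=> h; rewrite /Bn BE -[0]/(0%:C)%C lecR divr_ge0 // ltW.
have G2 : (2 * g)%:R = 2 * g%:R :> R by rewrite natrM.
have thr := @threshold_equiv R Q (2 * g%:R) n Q1.
split.
- split; [|move=> /thr h; apply: B_ge1].
    rewrite thr ?mulr_ge0 ?ler0n // ltr_pdivlMr // mulrC //.
  apply: (weil_sum_ge q1 t0 t4 _ Tle) => //.
    by rewrite (ler_nat _ 4) (leq_mul2l 2 2).
  by rewrite texp G2 h // mulr_ge0.
- move=> h; apply/B_ge0/(weil_sum_ge0 q1 g_ge2 t0 t4 Tle) => //.
  by rewrite t2' G2; lra.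
- move=> gn exc; apply/B_ge1/(weil_sum_ge_genus q1 g_ge2 t0 t4 Tle) => //.
    exact: card_finField_neq6.
  by apply/negP => /andP[g9 q5]; apply: exc; rewrite g_ge2.
split.
  move=> gn exc; apply/B_ge1/(weil_sum_ge_double_genus q1 g_ge2 t0 t4 Tle) => //.
  by apply/negP => /andP[g3 /eqP q2]; apply: exc; rewrite g_ge2.
move=> /andP[_ g3] q2 gn; apply: B_ge1.
have [//|[g2 n56]] := weil_sum_ge_binary q1 g_ge2 t0 t4 Tle q2 g3 gn.
have S5 := weil_sum5_gt0 t0 t4 Tle q2 g2.
rewrite /S q2 in S5 *; rewrite -/q q2 in omegaA.
(* Substituting g = 2 gives [omega] the domain ['I_2] of the surface lemmas. *)
clear -omegaA g2 n56 S5; subst g.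
case: n56 => ->; first exact: binary_surface5_ge omegaA S5.
exact: binary_surface6_ge omegaA.
Qed.
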